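(* Let $q\in(0,1)$ and consider $N^{(n)}_k$ under the measure $\mathcal{P}_n^{(q)}$. Let $k_n\in[n]$ denote a sequence of integers. As $n\to\infty$: (i) For fixed $k\in\mathbb{N}$, $\frac{N^{(n)}_k}{n}$ converges in distribution to the constant $(1-q)q^{k-1}$; (ii) If $\lim_{n\to\infty}nq^{k_n}=\infty$, then $\frac{N^{(n)}_{k_n}}{nq^{k_n}}$ converges in distribution to the constant $\frac{1-q}{q}$; (iii) If $L:=\lim_{n\to\infty}nq^{k_n}\in(0,\infty)$, then $N^{(n)}_{k_n}$ converges in distribution to the Poisson distribution with parameter $\frac{1-q}{q}L$; (iv) If $\lim_{n\to\infty}nq^{k_n}=0$, then $N^{(n)}_{k_n}$ converges in distribution to $0$.
   Context: Write $[n]=\{1,\ldots,n\}$ and let $S_n$ be the set of permutations of $[n]$, written in one-line notation $\sigma=\sigma_1\cdots\sigma_n$; $\sigma^{-1}_k$ is the position of $k$ in $\sigma$. A parking function of length $n$ is a sequence $\pi=(\pi_1,\ldots,\pi_n)\in[n]^n$ with $|\{i:\pi_i\le j\}|\ge j$ for all $j\in[n]$; $PF_n$ is the set of these. The inversion statistic is $I_n(\sigma)=\sum_{1\le i<j\le n}1_{\sigma_j<\sigma_i}$. For $j\in[n]$ let $I_{n,<j}(\sigma)=\sum_{1\le i<j}1_{\sigma^{-1}_j<\sigma^{-1}_i}$ (the number of inversions of $\sigma$ involving $j$ and a number less than $j$) and $\tilde I_{n,<j}=I_{n,<j}+1$. For $q\in(0,\infty)$, the Mallows measure on $S_n$ is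 $P_n^{(q)}(\sigma)=q^{I_n(\sigma)}/K_n$, where $K_n=\sum_{\rho\in S_n}q^{I_n(\rho)}$ is the normalizing constant; $P_n$ denotes the uniform measure on $S_n$. The map $(\sigma,\tau)\mapsto(\tilde I_{n,<\tau_1}(\sigma),\ldots,\tilde I_{n,<\tau_n}(\sigma))$ sends $S_n\times S_n$ into $PF_n$, and $\mathcal{P}_n^{(q)}$ denotes the probability measure on $PF_n$ that is the image of $P_n^{(q)}\times P_n$ under this map. For $\pi\in PF_n$ and $k\in[n]$, $N^{(n)}_k(\pi)=|\{i\in[n]:\pi_i=k\}|$ is the number of times $k$ appears as an entry of $\pi$. *)

(* Defs.v *)
From HB Require Import structures.
From mathcomp Require Import all_boot all_order all_algebra all_fingroup.
From mathcomp Require Import all_classical all_reals all_analysis.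

Set Implicit Arguments.
Unset Strict Implicit.
Unset Printing Implicit Defensive.

Import Order.TTheory GRing.Theory Num.Theory.
Import numFieldNormedType.Exports.

Local Open Scope classical_set_scope.
Local Open Scope ring_scope.

(* The index i : 'I_n stands for i.+1 in [n] = {1, ..., n}, both for positions
   and for values of permutations; inversions only depend on the order.
   The one-line notation of s : 'S_n is s 0, ..., s n.-1, and (s^-1)%g j is the
   position of j in s. *)

Definition inversions n (s : 'S_n) : nat :=
  (\sum_(i < n) \sum_(j < n | i < j) (s j < s i))%N.

Definition inversions_below n (s : 'S_n) (j : 'I_n) : nat :=
  (\sum_(i < n | i < j) ((s^-1)%g j < (s^-1)%g i))%N.

Lemma inversions_below_le n (s : 'S_n) (j : 'I_n) : (inversions_below s j <= j)%N.
Proof.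
rewrite /inversions_below.
apply: (@leq_trans (\sum_(i < n | (i < j)%N) 1)%N).
  by apply: leq_sum => i _; case: (_ < _)%N.
by rewrite -(big_ord_widen n (fun=> 1%N) (ltnW (ltn_ord j))) sum1_card card_ord.
Qed.

(* Unlike indices, entries of parking functions are not shifted: they are the
   nonzero elements of {0, ..., n}. *)
Definition parking n (p : {ffun 'I_n -> 'I_n.+1}) : bool :=
  [forall i, 0 < p i]%N &&
  [forall j : 'I_n.+1, (0 < j) ==> (j <= #|[set i | (p i <= j)%N]%SET|)]%N.

Record PF n := Parking { pf_val :> {ffun 'I_n -> 'I_n.+1} ; _ : parking pf_val }.

HB.instance Definition _ n := [isSub for @pf_val n].
HB.instance Definition _ n := [Finite of PF n by <:].

Definition occurrences n (k : nat) (p : PF n) : nat :=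
  #|[set i : 'I_n | p i == k :> nat]%SET|.

Lemma inversions_below_lt n (s : 'S_n) (j : 'I_n) :
  ((inversions_below s j).+1 < n.+1)%N.
Proof. exact: leq_ltn_trans (inversions_below_le s j) (ltn_ord j). Qed.

(* The i-th entry has value 1 + inversions_below st.1 (st.2 i). *)
Definition inversion_seq n (st : 'S_n * 'S_n) : {ffun 'I_n -> 'I_n.+1} :=
  [ffun i => Ordinal (inversions_below_lt st.1 (st.2 i))].

Lemma inversion_seq_parking n (st : 'S_n * 'S_n) : parking (inversion_seq st).
Proof.
apply/andP; split; first by apply/forallP => i; rewrite ffunE.
apply/forallP => j.
apply/implyP => j0.
have jn : (j <= n)%N by rewrite -ltnS.
rewrite -[leqLHS](card_ord j).
have inj : injective (fun i : 'I_j => (st.2^-1)%g (widen_ord jn i)).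
  by move=> x y /perm_inj /(congr1 val) /= /val_inj.
rewrite -(fintype.card_image inj); apply: subset_leq_card; apply/fintype.subsetP => i.
move=> /fintype.imageP[x _ ->]; rewrite inE ffunE /= permKV.
exact: leq_ltn_trans (inversions_below_le _ (widen_ord jn x)) (ltn_ord x).
Qed.

Definition to_PF n (st : 'S_n * 'S_n) : PF n := Parking (inversion_seq_parking st).

HB.instance Definition _ n := isPointed.Build (perm_type 'I_n) (1%g : 'S_n).
HB.instance Definition _ n := @isMeasurable.Build default_measure_display
  (perm_type 'I_n) discrete_measurable discrete_measurable0
  discrete_measurableC discrete_measurableU.

HB.instance Definition _ n := isPointed.Build (PF n) (to_PF (1%g, 1%g)).
HB.instance Definition _ n := @isMeasurable.Build default_measure_display
  (PF n) discrete_measurable discrete_measurable0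
  discrete_measurableC discrete_measurableU.

Lemma measurable_to_PF n : measurable_fun [set: 'S_n * 'S_n] (@to_PF n).
Proof.
move=> _ Y _; rewrite setTI.
rewrite (_ : _ @^-1` _ =
    \bigcup_(st in @to_PF n @^-1` Y) ([set st.1] `*` [set st.2])); last first.
  apply/seteqP; split=> [st Yst|[s t] [[s' t'] /= Y' [/= -> ->]//]].
  by exists st.
apply: fin_bigcup_measurable; first exact: finite_finset.
by move=> st _; exact: measurableX.
Qed.

HB.instance Definition _ n := isMeasurableFun.Build _ _ _ _
  (@to_PF n) (@measurable_to_PF n).

Lemma finite_weights_sigma_additive (R : realType) n (w : 'S_n -> R) :
    (forall s, 0 <= w s) ->
  semi_sigma_additive (fun A : set 'S_n => (\sum_(s | s \in A) w s)%:E).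
Proof.
move=> w0.
pose m (k : nat) : {measure set 'S_n -> \bar R} :=
  let s := nth 1%g (enum 'S_n) k in mscale (NngNum (w0 s)) (dirac s).
rewrite (_ : (fun A => _) = msum m #|'S_n|); first exact: measure_semi_sigma_additive.
apply/funext => A; rewrite /msum big_mkcond/=.
rewrite (reindex_onto (fun i : 'I_#|'S_n| => enum_val i) enum_rank) /=; last first.
  by move=> s _; rewrite enum_rankK.
rewrite (eq_bigl predT); last by move=> i; rewrite enum_valK eqxx.
rewrite -sumEFin; apply: eq_bigr => i _.
rewrite /m/= /mscale/= diracE (enum_val_nth 1%g).
by case: (_ \in A); rewrite -EFinM ?mulr1 ?mulr0.
Qed.

Section permutation_measures.
Context {R : realType}.
Variable n : nat.

Section mallows.
Variable q : {posnum R}.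

Definition mallows_norm : R := \sum_(s : 'S_n) q%:num ^+ inversions s.

Definition mallows (A : set 'S_n) : \bar R :=
  (\sum_(s | s \in A) q%:num ^+ inversions s / mallows_norm)%:E.

Lemma mallows_norm_gt0 : 0 < mallows_norm.
Proof.
rewrite /mallows_norm (bigD1 1%g)//= ltr_pwDl ?exprn_gt0//.
by apply: sumr_ge0 => s _; rewrite exprn_ge0.
Qed.

Let w_ge0 (s : 'S_n) : 0 <= q%:num ^+ inversions s / mallows_norm.
Proof. by rewrite divr_ge0 ?exprn_ge0 ?(ltW mallows_norm_gt0). Qed.

Let mallows0 : mallows set0 = 0%E.
Proof. by rewrite /mallows big_pred0// => s; rewrite in_set0. Qed.

Let mallows_ge0 A : (0 <= mallows A)%E.
Proof. by rewrite lee_fin; apply: sumr_ge0 => s _; exact: w_ge0. Qed.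

Let mallows_sigma_additive : semi_sigma_additive mallows.
Proof. exact: finite_weights_sigma_additive. Qed.

HB.instance Definition _ := isMeasure.Build _ _ _ mallows
  mallows0 mallows_ge0 mallows_sigma_additive.

Let mallowsT : mallows [set: 'S_n] = 1%E.
Proof.
rewrite /mallows (eq_bigl predT); last by move=> s; rewrite in_setT.
by rewrite -mulr_suml divff// gt_eqF// mallows_norm_gt0.
Qed.

HB.instance Definition _ := Measure_isProbability.Build _ _ _ mallows mallowsT.

End mallows.

Definition uniform_perm (A : set 'S_n) : \bar R :=
  (\sum_(s | s \in A) #|'S_n|%:R^-1)%:E.

Let uniform0 : uniform_perm set0 = 0%E.
Proof. by rewrite /uniform_perm big_pred0// => s; rewrite in_set0. Qed.

Let uniform_ge0 A : (0 <= uniform_perm A)%E.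
Proof. by rewrite lee_fin; apply: sumr_ge0 => s _; rewrite invr_ge0. Qed.

Let uniform_sigma_additive : semi_sigma_additive uniform_perm.
Proof. by apply: finite_weights_sigma_additive => s; rewrite invr_ge0. Qed.

HB.instance Definition _ := isMeasure.Build _ _ _ uniform_perm
  uniform0 uniform_ge0 uniform_sigma_additive.

Let uniformT : uniform_perm [set: 'S_n] = 1%E.
Proof.
rewrite /uniform_perm (eq_bigl (mem 'S_n)); last by move=> s; rewrite in_setT inE.
rewrite sumr_const -[X in X%:E]mulr_natr mulVf// pnatr_eq0 -lt0n.
by apply/card_gt0P; exists 1%g.
Qed.

HB.instance Definition _ := Measure_isProbability.Build _ _ _ uniform_perm uniformT.

End permutation_measures.
Arguments mallows {R} n q A.
Arguments uniform_perm {R} n A.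

(* The image on PF n of the product of the Mallows and uniform measures. *)
Definition parking_prob {R : realType} (n : nat) (q : {posnum R}) :
    probability (PF n) R :=
  distribution (mallows n q \x uniform_perm n)%E (@to_PF n).

Section PF_random_variables.
Context {R : realType} (n : nat) (q : {posnum R}) (f : PF n -> R).

(* PF n carries the discrete sigma-algebra: every f is a random variable. *)
Definition PF_fun : PF n -> R := f.

Let measurable_PF_fun : measurable_fun setT PF_fun.
Proof. by []. Qed.

HB.instance Definition _ := isMeasurableFun.Build _ _ _ _
  PF_fun measurable_PF_fun.

Definition PF_RV : {RV (parking_prob n q) >-> R} := [the {mfun _ >-> _} of PF_fun].

End PF_random_variables.

Lemma measurable_natr (R : realType) : measurable_fun setT (fun k : nat => k%:R : R).
Proof. by []. Qed.

Definition natr_fun (R : realType) (k : nat) : R := k%:R.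
HB.instance Definition _ (R : realType) := isMeasurableFun.Build _ _ _ _
  (@natr_fun R) (@measurable_natr R).

(* The second argument of poisson_prob is a dummy. *)
Definition poisson_real (R : realType) (rate : R) :
    probability R R :=
  distribution (poisson_prob rate 0) (@natr_fun R).

(* Pointwise convergence of the distribution functions at the continuity points
   of the limiting one. *)
Definition cvg_in_distribution (R : realType) d (T : nat -> measurableType d)
    (P : forall n, probability (T n) R) (X : forall n, {RV (P n) >-> R})
    (mu : probability R R) : Prop :=
  forall x : R, {for x, continuous (fun r : R => mu `]-oo, r]%classic)} ->
    cdf (X n) x @[n --> \oo] --> mu `]-oo, x]%classic.

(* Main.v *)
(* The number of occurrences of k is the number of j with I_{n,<j} = k - 1:
   the uniform permutation only shuffles the entries. Since the inversion table
   is a bijection from S_n onto the product of the {0, ..., j - 1} and the total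
   number of inversions is the sum of the table, the I_{n,<j} are independent
   truncated geometric variables under the Mallows measure. Thus N_k is a sum of
   independent Bernoulli variables with parameters q^(k-1) (1 - q) / (1 - q^j),
   k <= j <= n, whose sum is equivalent to (1 - q) n q^(k-1) unless n q^k
   vanishes. Chebyshev's inequality gives (i) and (ii), Markov's inequality
   (iv), and (iii) follows from the Stein-Chen recursion read off the derivative
   of the probability generating function. *)

Require Import Defs.
From HB Require Import structures.
From mathcomp Require Import all_boot all_order all_algebra all_fingroup.
From mathcomp Require Import all_classical all_reals all_analysis.
From mathcomp Require Import ring lra.

Set Implicit Arguments.
Unset Strict Implicit.
Unset Printing Implicit Defensive.

Import Order.TTheory GRing.Theory Num.Theory.
Import numFieldNormedType.Exports.

Local Open Scope classical_set_scope.
Local Open Scope ring_scope.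

(** * The inversion table as a bijection from permutations onto a product of intervals *)

Lemma sum_inversions_below n (s : 'S_n) :
  inversions s = (\sum_(j < n) inversions_below s j)%N.
Proof.
(* Pairs of positions become pairs of values; each inversion is charged to its larger value. *)
rewrite /inversions (reindex_inj (@perm_inj _ (s^-1)%g)) /=.
rewrite /inversions_below; apply: eq_bigr => j _.
rewrite (reindex_inj (@perm_inj _ (s^-1)%g)) /= big_mkcond [RHS]big_mkcond /=.
apply: eq_bigr => i _; rewrite !permKV.
by case: ltnP; case: ltnP.
Qed.

(** The value [u i] is the number of indices [j] with [u j < u i], so it can be read off the
    relative order of the values. *)
Lemma perm_ltn_inj n (s t : 'S_n) :
  (forall i j : 'I_n, (s i < s j)%N = (t i < t j)%N) -> s = t.
Proof.
move=> st.
have rank (u : 'S_n) i : nat_of_ord (u i) = #|[set j | (u j < u i)%N]%SET|.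
  transitivity (\sum_(j < u i) 1)%N; first by rewrite sum1_card card_ord.
  rewrite (big_ord_widen n (fun=> 1%N) (ltnW (ltn_ord _))).
  rewrite -sum1_card (reindex_inj (@perm_inj _ u)) /=.
  by apply: eq_bigl => j; rewrite inE.
apply/permP => i; apply: val_inj; rewrite /= (rank s) (rank t).
by apply: eq_card => j; rewrite !inE st.
Qed.

(** By induction on [m], the table determines the relative order of the positions of all values
    below [m]; [perm_ltn_inj] for the inverses concludes. *)
Lemma inversions_below_inj n (s t : 'S_n) :
  inversions_below s =1 inversions_below t -> s = t.
Proof.
move=> st; apply: invg_inj; apply: perm_ltn_inj.
have codeE (u : 'S_n) j : inversions_below u j =
    #|[set i : 'I_n | (i < j)%N && ((u^-1)%g j < (u^-1)%g i)%N]%SET|.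
  rewrite /inversions_below -sum1_card big_mkcond [RHS]big_mkcond /=.
  by apply: eq_bigr => i _; rewrite inE; case: ltnP.
(* Among positions of 0, ..., m, the rank of the position of m tells on which
   side of the position of i it lies. *)
have step (u : 'S_n) (i j : 'I_n) : (i < j)%N ->
    ((u^-1)%g j < (u^-1)%g i)%N =
    (#|[set h : 'I_n | (h < j)%N && ((u^-1)%g i < (u^-1)%g h)%N]%SET|
      < inversions_below u j)%N.
  move=> ij; rewrite codeE; apply/idP/idP => [lt_ji|].
    apply: proper_card; apply/fintype.properP; split.
      apply/fintype.subsetP => h; rewrite !inE => /andP[-> /=].
      exact: ltn_trans.
    by exists i; rewrite !inE ?ij ?ltnn ?andbF.
  apply: contraTT; rewrite -leqNgt -leqNgt => le_ij; apply: subset_leq_card.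
  apply/fintype.subsetP => h; rewrite !inE => /andP[-> /=].
  exact: leq_ltn_trans.
have main m : forall i j : 'I_n, (i < m)%N -> (j < m)%N ->
    ((s^-1)%g i < (s^-1)%g j)%N = ((t^-1)%g i < (t^-1)%g j)%N.
  elim: m => // m IH.
  have max_l (i j : 'I_n) : i = m :> nat -> (j < m)%N ->
      ((s^-1)%g i < (s^-1)%g j)%N = ((t^-1)%g i < (t^-1)%g j)%N.
    move=> im jm; rewrite !step ?im// st; congr (_ < _)%N; apply: eq_card => h.
    by rewrite !inE; case: ltnP => //= hm; rewrite IH.
  move=> i j; rewrite !ltnS leq_eqVlt => /predU1P[im|im].
    rewrite leq_eqVlt => /predU1P[jm|jm]; last exact: max_l.
    by have -> : i = j; [apply: val_inj; rewrite /= im jm | rewrite !ltnn].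
  rewrite leq_eqVlt => /predU1P[jm|jm]; last exact: IH.
  have asym (u : 'S_n) : ((u^-1)%g i < (u^-1)%g j)%N =
      ~~ ((u^-1)%g j < (u^-1)%g i)%N.
    rewrite ltn_neqAle -leqNgt; case: eqP => //= /val_inj/perm_inj ij.
    by move: im; rewrite ij jm ltnn.
  by rewrite (asym s) (asym t) max_l.
by move=> i j; apply: (main n).
Qed.

Definition inversion_table n (s : 'S_n) : {ffun 'I_n -> 'I_n} :=
  [ffun j => Ordinal (leq_ltn_trans (inversions_below_le s j) (ltn_ord j))].

Lemma inversion_table_inj n : injective (@inversion_table n).
Proof.
move=> s t /ffunP st; apply: inversions_below_inj => j.
by have := congr1 val (st j); rewrite !ffunE.
Qed.

(** One inclusion is the bound on table entries; equality follows because the table is injective and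
    both sides have [n!] elements. *)
Lemma codom_inversion_table n :
  codom (@inversion_table n) =i family (fun i j : 'I_n => (j <= i)%N).
Proof.
apply/subset_cardP; last first.
  apply/fintype.subsetP => _ /codomP[s ->]; apply/familyP => i.
  by rewrite ffunE unfold_in /= inversions_below_le.
rewrite (card_codom (@inversion_table_inj n)) card_family.
transitivity n`!; first exact: card_Sn.
rewrite fact_prod big_add1 /= big_mkord foldrE big_map.
rewrite -big_enum; apply: eq_bigr => i _.
transitivity (\sum_(j < i.+1) 1)%N; first by rewrite sum1_card card_ord.
by rewrite (big_ord_widen n (fun=> 1%N) (ltn_ord i)) sum1_card.
Qed.

(** This is the independence of the table entries: summing over permutations is summing over all
    admissible tables, and distributivity factors the sum. *)
Lemma sum_prod_inversions_below (A : comNzRingType) n (F : 'I_n -> nat -> A) :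
  \sum_(s : 'S_n) \prod_(j < n) F j (inversions_below s j) =
  \prod_(j < n) \sum_(a < j.+1) F j a.
Proof.
transitivity (\prod_(j < n) \sum_(a < n | (a <= j)%N) F j a); last first.
  apply: eq_bigr => j _.
  by rewrite (big_ord_widen_cond n xpredT (F j) (ltn_ord j)).
rewrite bigA_distr_big_dep.
rewrite -(eq_bigl _ _ (@codom_inversion_table n)).
have uniq_codom : uniq (codom (@inversion_table n)).
  exact/injectiveP/inversion_table_inj.
rewrite -(big_uniq _ uniq_codom)/=.
rewrite big_image; apply: eq_big => //= s _.
by apply: eq_bigr => j _; rewrite ffunE.
Qed.

(** * Sums of independent Bernoulli variables: moments, Stein-Chen recursion, Poisson limit *)

Section bernoulli_sums.
Context {R : realType}.
Implicit Types (p : nat -> R) (n m : nat).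

(* The probability generating function of a sum of n independent Bernoulli
   variables with parameters p 0, ..., p n.-1. *)
Definition bernoulli_pgf p n : {poly R} :=
  \prod_(j < n) ((1 - p j)%:P + p j *: 'X).

Lemma bernoulli_pgfS p n : bernoulli_pgf p n.+1 =
  bernoulli_pgf p n * ((1 - p n)%:P + p n *: 'X).
Proof. by rewrite /bernoulli_pgf big_ord_recr. Qed.

Lemma deriv_bernoulli (x : R) : ((1 - x)%:P + x *: 'X)^`() = x%:P.
Proof. by rewrite derivD derivC derivZ derivX add0r alg_polyC. Qed.

Lemma coefM_bernoulli (G : {poly R}) (x : R) m :
  (G * ((1 - x)%:P + x *: 'X))`_m =
  (1 - x) * G`_m + x * (if m is m'.+1 then G`_m' else 0).
Proof.
rewrite mulrDr coefD mulrC coefCM; congr (_ + _).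
by rewrite -scalerAr coefZ coefMX; case: m.
Qed.

Lemma bernoulli_pgf_1 p n : (bernoulli_pgf p n).[1] = 1.
Proof.
rewrite horner_prod big1// => j _.
by rewrite !hornerE/= subrK.
Qed.

Lemma deriv_bernoulli_pgf_1 p n :
  (bernoulli_pgf p n)^`().[1] = \sum_(j < n) p j.
Proof.
elim: n => [|n IH]; first by rewrite /bernoulli_pgf !big_ord0 derivC horner0.
rewrite bernoulli_pgfS big_ord_recr derivM deriv_bernoulli.
by rewrite !hornerE/= IH bernoulli_pgf_1; ring.
Qed.

(** The second factorial moment, that is, the sum of [p i * p j] over ordered pairs of distinct
    indices. *)
Lemma deriv2_bernoulli_pgf_1 p n : (bernoulli_pgf p n)^`()^`().[1] =
  (\sum_(j < n) p j) ^+ 2 - \sum_(j < n) p j ^+ 2.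
Proof.
elim: n => [|n IH].
  by rewrite /bernoulli_pgf !big_ord0 !derivC horner0 expr0n subr0.
rewrite bernoulli_pgfS !big_ord_recr derivM deriv_bernoulli.
rewrite derivD !derivM deriv_bernoulli derivC.
by rewrite !hornerE/= IH deriv_bernoulli_pgf_1; ring.
Qed.

Lemma convex_combination_bounds (x a b c d : R) : 0 <= x <= 1 ->
  c <= a <= d -> c <= b <= d -> c <= (1 - x) * a + x * b <= d.
Proof.
move=> /andP[x0 x1] /andP[ca ad] /andP[cb bd].
have y0 : 0 <= 1 - x by rewrite subr_ge0.
have := (ler_wpM2l y0 ca, ler_wpM2l y0 ad, ler_wpM2l x0 cb, ler_wpM2l x0 bd).
by move=> [[[? ?] ?] ?]; apply/andP; split; lra.
Qed.

Lemma coef_bernoulli_pgf_bounds p n m : (forall j, 0 <= p j <= 1) ->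
  0 <= (bernoulli_pgf p n)`_m <= 1.
Proof.
move=> p01; elim: n m => [|n IH] m.
  rewrite /bernoulli_pgf big_ord0 coef1.
  by case: (m == 0)%N; rewrite ?lexx ler01.
rewrite bernoulli_pgfS coefM_bernoulli; apply: convex_combination_bounds => //.
by case: m => [|m']; rewrite ?lexx ?ler01.
Qed.

(* The Stein-Chen comparison with the recursion
   (m + 1) g (m + 1) = lambda g m satisfied by the Poisson weights. *)
Lemma coef_bernoulli_pgf_recursion p n m : (forall j, 0 <= p j <= 1) ->
  `|(bernoulli_pgf p n)`_m.+1 *+ m.+1 -
    (\sum_(j < n) p j) * (bernoulli_pgf p n)`_m| <= \sum_(j < n) p j ^+ 2.
Proof.
move=> p01.
rewrite -coef_deriv -coefCM -coefB.
elim: n m => [|n IH] m.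
  by rewrite /bernoulli_pgf !big_ord0 derivC polyC0 mul0r subrr coef0 normr0.
rewrite !big_ord_recr /= bernoulli_pgfS derivM deriv_bernoulli.
set G := bernoulli_pgf p n in IH *; set x := p n.
set D := G^`() - _ in IH.
(* A new variable multiplies the error polynomial [D] by its own factor, which takes convex
   combinations of coefficients, and adds [x ^+ 2] times a difference of probabilities. *)
rewrite (_ : _ - _ = D * ((1 - x)%:P + x *: 'X) + x ^+ 2 *: (G - G * 'X));
  last first.
  rewrite /D -!mul_polyC !polyCD !polyCN polyC1 expr2 polyCM; ring.
have /andP[x0 x1] : 0 <= x <= 1 := p01 n.
rewrite coefD coefM_bernoulli coefZ (coefB G) coefMX.
set e := _ * D`_m + _; set f := _ - _.
have : `|e| <= \sum_(j < n) p j ^+ 2.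
  have : `|(if m is m'.+1 then D`_m' else 0)| <= \sum_(j < n) p j ^+ 2.
    by case: (m) => [|m'] //; rewrite normr0 (le_trans _ (IH 0%N)).
  by have := IH m; rewrite /e !ler_norml => ? ?;
    apply: convex_combination_bounds; rewrite // x0 x1.
have : `|f| <= 1.
  have /andP[? ?] := coef_bernoulli_pgf_bounds n m p01.
  have /andP[? ?] := coef_bernoulli_pgf_bounds n m.-1 p01.
  rewrite /f -/G ler_norml; case: (m == 0)%N; apply/andP; split; lra.
rewrite !ler_norml => /andP[? ?] /andP[? ?]; apply/andP; split; nra.
Qed.

Lemma coef0_bernoulli_pgf p n :
  (bernoulli_pgf p n)`_0 = \prod_(j < n) (1 - p j).
Proof.
rewrite coef0_prod; apply: eq_bigr => j _.
by rewrite coefD coefC coefZ coefX mulr0 addr0.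
Qed.

(** Union bound: some variable is nonzero with probability at most the mean. *)
Lemma coef0_bernoulli_pgf_ge p n : (forall j, 0 <= p j <= 1) ->
  1 - \sum_(j < n) p j <= (bernoulli_pgf p n)`_0.
Proof.
move=> p01; elim: n => [|n IH].
  by rewrite /bernoulli_pgf !big_ord0 coef1 subr0.
rewrite bernoulli_pgfS coefM_bernoulli mulr0 addr0 big_ord_recr /=.
have /andP[? ?] := p01 n; have /andP[? ?] := coef_bernoulli_pgf_bounds n 0 p01.
nra.
Qed.

(** Factor by factor: the upper bound is [1 - x <= expR (- x)]; the lower one comes from [(1 - x)^-1
    <= 1 + x / (1 - e) <= expR (x / (1 - e))] for [0 <= x <= e]. *)
Lemma coef0_bernoulli_pgf_expR p n (e : R) : e < 1 ->
  (forall j, 0 <= p j <= e) ->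
  expR (- (\sum_(j < n) p j) / (1 - e)) <= (bernoulli_pgf p n)`_0
    <= expR (- \sum_(j < n) p j).
Proof.
move=> e1 pe; rewrite coef0_bernoulli_pgf mulNr mulr_suml -!sumrN !expR_sum.
apply/andP; split; apply: ler_prod => j _; have /andP[p0 pj] := pe j.
  rewrite expR_ge0 expRN invf_ple ?posrE ?expR_gt0//; last lra.
  apply: le_trans (expR_ge1Dx _).
  rewrite -[X in _ <= X + _](@divff _ (1 - e)); last by rewrite subr_eq0 gt_eqF.
  rewrite -mulrDl ler_pdivlMr; last lra.
  rewrite mulrC ler_pdivrMr; last lra.
  nra.
by rewrite expR_ge1Dx andbT subr_ge0; lra.
Qed.

(** Poisson limit by induction on [m]: the exponential bounds settle [m = 0], and the Stein-Chen
    error, at most [e n] times the mean, vanishes in the recursion. *)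
Lemma coef_bernoulli_pgf_cvg (p : nat -> nat -> R) (e : nat -> R) (l : R) m :
  (forall n j, 0 <= p n j <= 1) -> (forall n j, p n j <= e n) ->
  e n @[n --> \oo] --> 0 ->
  \sum_(j < n) p n j @[n --> \oo] --> l ->
  (bernoulli_pgf (p n) n)`_m @[n --> \oo] --> l ^+ m / m`!%:R * expR (- l).
Proof.
move=> p01 pe e0 pl; elim: m => [|m IH].
  rewrite expr0 fact0 divr1 mul1r.
  apply: (@squeeze_cvgr _ _ _ _
    (fun n => expR (- (\sum_(j < n) p n j) / (1 - e n)))
    (fun n => expR (- \sum_(j < n) p n j))).
  - have : \forall n \near \oo, e n < 1 by apply: cvgr_lt e0 _ ltr01.
    apply: filterS => n en.
    apply: coef0_bernoulli_pgf_expR => // j.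
    by rewrite pe; have /andP[->] := p01 n j.
  - apply: continuous_cvg; first exact: continuous_expR.
    rewrite -[X in _ --> X]divr1; apply: cvgM; first exact: cvgN.
    apply: cvgV; first exact: oner_neq0.
    by rewrite -[X in _ --> X]subr0; apply: cvgB => //; exact: cvg_cst.
  - by apply: continuous_cvg; [exact: continuous_expR | exact: cvgN].
have rec : ((bernoulli_pgf (p n) n)`_m.+1 *+ m.+1 -
    (\sum_(j < n) p n j) * (bernoulli_pgf (p n) n)`_m) @[n --> \oo] --> (0 : R).
  apply: norm_cvg0.
  apply: (@squeeze_cvgr _ _ _ _ (fun=> 0) (fun n => e n * \sum_(j < n) p n j)).
  - apply: nearW => n; rewrite normr_ge0 /=.
    apply: le_trans (coef_bernoulli_pgf_recursion _ _ (p01 n)) _.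
    rewrite mulr_sumr; apply: ler_sum => j _; rewrite expr2.
    by have /andP[? ?] := p01 n j; rewrite ler_wpM2r.
  - exact: cvg_cst.
  - by rewrite -[X in _ --> X](mul0r l); exact: cvgM.
have gE n : (bernoulli_pgf (p n) n)`_m.+1 =
    ((bernoulli_pgf (p n) n)`_m.+1 *+ m.+1 -
      (\sum_(j < n) p n j) * (bernoulli_pgf (p n) n)`_m +
      (\sum_(j < n) p n j) * (bernoulli_pgf (p n) n)`_m) / m.+1%:R.
  by rewrite subrK -[X in X / _]mulr_natr mulfK// pnatr_eq0.
rewrite (funext gE) (_ : _ * expR _ =
    (0 + l * (l ^+ m / m`!%:R * expR (- l))) / m.+1%:R); last first.
  by rewrite factS natrM invfM exprS; ring.
by apply: cvgMl; apply: cvgD => //; exact: cvgM.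
Qed.

End bernoulli_sums.

(* By occurrences_to_PF below, the multiplicity of the entry a.+1. *)
Definition count_below n a (s : 'S_n) : nat :=
  #|[set j | inversions_below s j == a]%SET|.

Lemma occurrences_to_PF n k (st : 'S_n * 'S_n) : (0 < k)%N ->
  occurrences k (to_PF st) = count_below k.-1 st.1.
Proof.
case: k => // a _; rewrite /count_below -(card_preimset _ (@perm_inj _ st.2)).
by apply: eq_card => i; rewrite !inE ffunE /= eqSS.
Qed.

(** * The law of a table entry and the generating function of the count *)

Section code_probabilities.
Context {R : realType}.
Implicit Types q : R.

(* The law of I_{n,<j+1} under the Mallows measure: a geometric variable
   conditioned to be at most j. *)
Definition code_prob q a j : R :=
  (a <= j)%N%:R * q ^+ a * (1 - q) / (1 - q ^+ j.+1).

Lemma code_prob_denom q j : 0 < q < 1 -> 1 - q <= 1 - q ^+ j.+1.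
Proof.
move=> /andP[q0 q1]; rewrite lerD2l lerN2 exprS ler_piMr ?exprn_ile1 ?ltW//.
Qed.

Lemma code_prob_itv q a j : 0 < q < 1 -> 0 <= code_prob q a j <= q ^+ a.
Proof.
move=> q01; have q1D := code_prob_denom j q01; have /andP[q0 q1] := q01.
have q2 : 0 < 1 - q by rewrite subr_gt0.
have D0 := lt_le_trans q2 q1D.
have qa : 0 <= q ^+ a by rewrite exprn_ge0 ?ltW.
rewrite /code_prob; case: (a <= j)%N; last by rewrite !mul0r lexx.
rewrite mul1r divr_ge0 ?mulr_ge0//=; try exact: ltW.
by rewrite ler_pdivrMr// ler_wpM2l.
Qed.

Lemma code_prob_itv01 q a j : 0 < q < 1 -> 0 <= code_prob q a j <= 1.
Proof.
move=> q01; have /andP[-> /= le] := code_prob_itv a j q01.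
have /andP[q0 q1] := q01.
by apply: le_trans le _; rewrite exprn_ile1 ?ltW.
Qed.

Lemma sum_geometric q n : q != 1 ->
  \sum_(a < n) q ^+ a = (1 - q ^+ n) / (1 - q).
Proof.
move=> q1; have q1' : 1 - q != 0 by rewrite subr_eq0 eq_sym.
by apply: (mulIf q1'); rewrite divfK// -[RHS]opprB subrX1; ring.
Qed.

Lemma mallows_normE n (q : {posnum R}) :
  mallows_norm n q = \prod_(j < n) \sum_(a < j.+1) q%:num ^+ a.
Proof.
rewrite -(sum_prod_inversions_below (fun=> GRing.exp q%:num)).
by apply: eq_bigr => s _; rewrite sum_inversions_below expr_sum.
Qed.

(** Both the weight and the monomial are products over the table entries, so the sum factors;
    normalizing the factor of [j] by [S j] leaves a Bernoulli factor. *)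
Lemma mallows_pgf n (q : {posnum R}) a : q%:num < 1 ->
  \sum_(s : 'S_n) (q%:num ^+ inversions s / mallows_norm n q) *:
    'X^(count_below a s) = bernoulli_pgf (code_prob q%:num a) n.
Proof.
have : 0 < q%:num by []; set r := q%:num => r0 q1.
pose S j := \sum_(c < j.+1) r ^+ c.
have S0 j : S j != 0.
  rewrite /S big_ord_recl gt_eqF// ltr_pwDl//.
  by apply: sumr_ge0 => c _; rewrite exprn_ge0// ltW.
transitivity ((mallows_norm n q)^-1 *:
    \sum_(s : 'S_n) \prod_(j < n)
      (r ^+ inversions_below s j *: 'X^(inversions_below s j == a))).
  rewrite scaler_sumr; apply: eq_bigr => s _.
  rewrite mulrC -scalerA; congr (_ *: _).
  rewrite scaler_prod -expr_sum -sum_inversions_below; congr (_ *: _).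
  rewrite -expr_sum; congr ('X^ _).
  rewrite /count_below -sum1_card big_mkcond.
  by apply: eq_bigr => j _; rewrite inE; case: eqP.
rewrite (sum_prod_inversions_below (fun _ c => r ^+ c *: 'X^(c == a))).
rewrite mallows_normE -prodfV -scaler_prod; apply: eq_bigr => j _.
rewrite -/(S j); apply: (canLR (scalerK (S0 j))).
have pS : S j * code_prob r a j = (a <= j)%N%:R * r ^+ a.
  have D0 : 1 - r ^+ j.+1 != 0.
    rewrite gt_eqF// (lt_le_trans _ (code_prob_denom _ _)) ?subr_gt0//.
    by rewrite r0.
  rewrite /S sum_geometric ?lt_eqF// /code_prob; field.
  by rewrite D0 subr_eq0 gt_eqF.
rewrite scalerDr scalerA pS -mul_polyC -polyCM mulrBr mulr1 pS.
(* If [a <= j], only the term [c = a] carries ['X]; otherwise the factor is constant and the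
   Bernoulli parameter is 0. *)
have [aj|aj] := leqP a j.
  rewrite mul1r /S (bigD1 (Ordinal (aj : a < j.+1)%N)) //= eqxx.
  rewrite [X in (X - _)%:P](bigD1 (Ordinal (aj : a < j.+1)%N)) //=.
  rewrite addrAC subrr add0r addrC; congr (_ + _).
  rewrite rmorph_sum; apply: eq_bigr => c.
  by rewrite -val_eqE /= => /negPf ->; rewrite expr0 alg_polyC.
rewrite mul0r scale0r addr0 subr0 rmorph_sum; apply: eq_bigr => c _.
by rewrite ltn_eqF ?expr0 ?alg_polyC// (leq_trans (ltn_ord c)).
Qed.

End code_probabilities.

(** * Moments and tails of the count, and transfer to parking functions *)

Section mallows_count.
Context {R : realType} (q : {posnum R}) (q1 : q%:num < 1) (n a : nat).

Local Notation w s := (q%:num ^+ inversions s / mallows_norm n q).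
Local Notation mean := (\sum_(j < n) code_prob q%:num a j).

Lemma mallows_weight_ge0 (s : 'S_n) : 0 <= w s.
Proof. by rewrite divr_ge0 ?exprn_ge0// ltW// mallows_norm_gt0. Qed.

Lemma sum_mallows_weight : \sum_(s : 'S_n) w s = 1.
Proof. by rewrite -mulr_suml divff// gt_eqF// mallows_norm_gt0. Qed.

Lemma mallows_count_pmf m : \sum_(s : 'S_n | count_below a s == m) w s =
  (bernoulli_pgf (code_prob q%:num a) n)`_m.
Proof. by rewrite -mallows_pgf// coef_sumMXn. Qed.

Lemma mallows_count_mean :
  \sum_(s : 'S_n) w s * (count_below a s)%:R = mean.
Proof.
rewrite -deriv_bernoulli_pgf_1 -mallows_pgf// linear_sum horner_sum.
apply: eq_bigr => s _; rewrite /= derivZ derivXn.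
by rewrite hornerZ hornerMn hornerXn expr1n.
Qed.

Lemma mallows_count_fact2 : \sum_(s : 'S_n) w s *
    ((count_below a s)%:R * ((count_below a s)%:R - 1)) =
  mean ^+ 2 - \sum_(j < n) code_prob q%:num a j ^+ 2.
Proof.
rewrite -deriv2_bernoulli_pgf_1 -mallows_pgf// !linear_sum horner_sum.
apply: eq_bigr => s _; rewrite /= !derivZ derivXn derivMn derivXn.
rewrite hornerZ !hornerMn hornerXn expr1n -mulrnA; congr (_ * _).
case: (count_below a s) => [|c]; first by rewrite mul0r.
by rewrite natrM /= -natr1; ring.
Qed.

(** The two factorial moments give the variance as the mean minus the sum of the squared
    parameters. *)
Lemma mallows_count_variance :
  \sum_(s : 'S_n) w s * ((count_below a s)%:R - mean) ^+ 2 <= mean.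
Proof.
rewrite (eq_bigr (fun s => w s * ((count_below a s)%:R *
    ((count_below a s)%:R - 1)) + (1 - 2 * mean) *
    (w s * (count_below a s)%:R) + mean ^+ 2 * w s)); last by move=> s _; ring.
rewrite !big_split /= -!mulr_sumr mallows_count_mean mallows_count_fact2.
rewrite sum_mallows_weight.
have : 0 <= \sum_(j < n) code_prob q%:num a j ^+ 2.
  by apply: sumr_ge0 => j _; rewrite sqr_ge0.
by nra.
Qed.

Lemma mallows_count_chebyshev (d : R) : 0 < d ->
  \sum_(s : 'S_n | d <= `|(count_below a s)%:R - mean|) w s <= mean / d ^+ 2.
Proof.
move=> d0; rewrite ler_pdivlMr ?exprn_gt0//.
apply: le_trans mallows_count_variance.
rewrite mulr_suml big_mkcond /=; apply: ler_sum => s _.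
case: ifP => [ds|_]; last by rewrite mulr_ge0 ?mallows_weight_ge0 ?sqr_ge0.
rewrite ler_wpM2l ?mallows_weight_ge0// -[leRHS]real_normK ?num_real//.
by rewrite ler_sqr ?nnegrE// ltW.
Qed.

(** By [occurrences_to_PF] the event depends on the first permutation alone, so it is a rectangle
    [A] times the full space, and the uniform factor has mass 1. *)
Lemma cdf_PF_RV k (g : nat -> R) x : (0 < k)%N ->
  cdf (PF_RV q (fun p : PF n => g (occurrences k p))) x =
  (\sum_(s : 'S_n | g (count_below k.-1 s) <= x) w s)%:E.
Proof.
move=> k0.
pose A : set 'S_n := [set s | g (count_below k.-1 s) <= x].
have -> : cdf (PF_RV q (fun p : PF n => g (occurrences k p))) x =
    (mallows n q \x uniform_perm n)%E (A `*` setT).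
  rewrite /cdf /distribution /pushforward /=; congr (_ _).
  apply/seteqP; split=> [st|st] /=;
    rewrite /PF_fun /A /= in_itv /= occurrences_to_PF//; by move=> [].
rewrite product_measure1E//= [X in (_ * X)%E](_ : _ = 1%E) ?mule1; last first.
  exact: (@probability_setT _ _ _ (uniform_perm n)).
rewrite /mallows; congr (_%:E); apply: eq_bigl => s.
by apply/idP/idP; rewrite ?inE.
Qed.

End mallows_count.

(** * Asymptotics of the mean *)

Section mean_asymptotics.
Context {R : realType}.
Implicit Types q : R.

Lemma sum_geometric_le q n : 0 < q < 1 -> \sum_(a < n) q ^+ a <= (1 - q)^-1.
Proof.
move=> /andP[q0 q1]; rewrite sum_geometric ?lt_eqF// -[leRHS]mul1r.
rewrite ler_wpM2r ?invr_ge0 ?subr_ge0 ?(ltW q1)//.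
by rewrite gerBl exprn_ge0 ?ltW.
Qed.

(** Each of the [a] copies of [q ^+ a] is at most [q ^+ j], for [j < a]. *)
Lemma mul_expr_le q a : 0 < q < 1 -> a%:R * q ^+ a <= (1 - q)^-1.
Proof.
move=> q01; apply: le_trans (sum_geometric_le a q01).
rewrite -[X in X%:R]card_ord -sum1_card natr_sum mulr_suml.
apply: ler_sum => j _; have /andP[q0 q1] := q01.
by rewrite mul1r ler_wiXn2l ?(ltW q0) ?(ltW q1)// ltnW.
Qed.

(** Replacing each denominator by 1 decreases the terms, and at least [n - a] indices satisfy
    [a <= j]; for [n < a] the left side is negative or zero. *)
Lemma sum_code_prob_ge q a n : 0 < q < 1 ->
  (1 - q) * (n%:R * q ^+ a - a%:R * q ^+ a) <= \sum_(j < n) code_prob q a j.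
Proof.
move=> q01; have /andP[q0 q1] := q01.
have qa : 0 <= q ^+ a by rewrite exprn_ge0 ?ltW.
apply: (@le_trans _ _ (\sum_(j < n) (a <= j)%N%:R * q ^+ a * (1 - q))).
  rewrite -!mulr_suml -mulrBl mulrC ler_wpM2r ?subr_ge0 ?(ltW q1)// ler_wpM2r//.
  elim: n => [|n IH]; first by rewrite big_ord0 sub0r oppr_le0.
  rewrite big_ord_recr /=; have [an|na] := leqP a n.
    by rewrite -natr1 addrAC lerD2r.
  rewrite addr0; apply: le_trans (_ : 0 <= _).
    by rewrite subr_le0 ler_nat.
  by apply: sumr_ge0.
apply: ler_sum => j _; rewrite /code_prob ler_peMr//.
  by rewrite !mulr_ge0// subr_ge0 ltW.
have D0 : 0 < 1 - q ^+ j.+1.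
  by apply: lt_le_trans (code_prob_denom _ q01); rewrite subr_gt0.
by rewrite invf_ge1// gerBl exprn_ge0 ?ltW.
Qed.

(** The denominator of index [j] costs at most an extra [q ^+ a * q ^+ j], and these errors sum
    geometrically. *)
Lemma sum_code_prob_le q a n : 0 < q < 1 -> \sum_(j < n) code_prob q a j <=
  (1 - q) * (n%:R * q ^+ a) + q ^+ a / (1 - q).
Proof.
move=> q01; have /andP[q0 q1] := q01.
have qa : 0 <= q ^+ a by rewrite exprn_ge0 ?ltW.
apply: (@le_trans _ _ (\sum_(j < n) ((1 - q) * q ^+ a + q ^+ a * q ^+ j))).
  apply: ler_sum => j _.
  have D0 : 0 < 1 - q ^+ j.+1.
    by apply: lt_le_trans (code_prob_denom _ q01); rewrite subr_gt0.
  rewrite /code_prob ler_pdivrMr//.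
  apply: (@le_trans _ _ (q ^+ a * (1 - q))).
    by rewrite ler_wpM2r ?subr_ge0 ?(ltW q1)// ler_piMl//; case: leqP.
  rewrite [X in _ <= (X + _) * _]mulrC -mulrDr -mulrA ler_wpM2l// exprS.
  have /andP[Q0 Q1] : 0 <= q ^+ j <= 1 by rewrite exprn_ge0 ?exprn_ile1 ?ltW.
  (* This product and the next one add up to the slack of the inequality. *)
  have : 0 <= q ^+ j * (1 - q ^+ j) * q by rewrite !mulr_ge0 ?subr_ge0// ltW.
  have : 0 <= q ^+ j * (1 - q) * (1 - q) by rewrite !mulr_ge0 ?subr_ge0// ltW.
  by lra.
rewrite big_split /= sumr_const card_ord -mulrnAr -[_ *+ n]mulr_natl lerD2l.
by rewrite -mulr_sumr ler_wpM2l// sum_geometric_le.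
Qed.

(** Here [s] is the normalizing scale. The last two limits kill the errors [a * q ^+ a] and
    [q ^+ a / (1 - q)] of the lower and upper bounds. *)
Lemma sum_code_prob_cvg q (a : nat -> nat) (s : nat -> R) (c : R) :
  0 < q < 1 -> (\forall n \near \oo, 0 < s n) ->
  n%:R * q ^+ a n / s n @[n --> \oo] --> c ->
  (a n)%:R * q ^+ a n / s n @[n --> \oo] --> 0 ->
  q ^+ a n / s n @[n --> \oo] --> 0 ->
  (\sum_(j < n) code_prob q (a n) j) / s n @[n --> \oo] --> (1 - q) * c.
Proof.
move=> q01 s0 tc a0 q0.
apply: (@squeeze_cvgr _ _ _ _
  (fun n => (1 - q) * (n%:R * q ^+ a n / s n - (a n)%:R * q ^+ a n / s n))
  (fun n => (1 - q) * (n%:R * q ^+ a n / s n) + q ^+ a n / s n / (1 - q))).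
- apply: filterS s0 => n sn; apply/andP; split.
    rewrite -mulrBl ler_pdivlMr// -[X in X <= _]mulrA divfK ?gt_eqF//.
    exact: sum_code_prob_ge.
  rewrite ler_pdivrMr// mulrDl -[X in _ <= X + _]mulrA divfK ?gt_eqF//.
  rewrite [X in _ + X](_ : _ = q ^+ a n / (1 - q)); last first.
    by rewrite mulrAC divfK ?gt_eqF.
  exact: sum_code_prob_le.
- by rewrite -[in X in _ --> X](subr0 c); apply: cvgMr; apply: cvgB.
- rewrite -[X in _ --> X]addr0; apply: cvgD; first exact: cvgMr.
  by rewrite -(mul0r (1 - q)^-1); apply: cvgMl.
Qed.

End mean_asymptotics.

(** * Convergence of distribution functions by concentration *)

Section convergence.
Context {R : realType} (q : {posnum R}) (q1 : q%:num < 1) (k_ : nat -> nat).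
Hypothesis k_gt0 : \forall n \near \oo, (0 < k_ n)%N.

Let w n (s : 'S_n) := q%:num ^+ inversions s / mallows_norm n q.
Let mean n := \sum_(j < n) code_prob q%:num (k_ n).-1 j.

Lemma cdf_occurrences_cvg (g : nat -> nat -> R) x (l : R) :
  \sum_(s : 'S_n | g n (count_below (k_ n).-1 s) <= x) w s @[n --> \oo] --> l ->
  cdf (PF_RV q (fun p : PF n => g n (occurrences (k_ n) p))) x @[n --> \oo]
    --> l%:E.
Proof.
move=> gl; apply: cvg_trans (_ : (fun n => (\sum_(s : 'S_n |
    g n (count_below (k_ n).-1 s) <= x) w s)%:E) @ \oo --> l%:E).
  apply: near_eq_cvg; apply: filterS k_gt0 => n kn.
  by rewrite cdf_PF_RV.
by apply: cvg_EFin => //; exact: nearW.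
Qed.

(** The variance of the count is at most its mean, so after division by [s n] it is at most
    [mean n / s n ^+ 2], which vanishes; Chebyshev's inequality applies. *)
Lemma occurrences_concentration (s : nat -> R) (c x : R) : x != c ->
  s n @[n --> \oo] --> +oo ->
  mean n / s n @[n --> \oo] --> c ->
  cdf (PF_RV q (fun p : PF n => (occurrences (k_ n) p)%:R / s n)) x
    @[n --> \oo] --> (c <= x)%R%:R%:E.
Proof.
move=> xc soo mc; apply: (@cdf_occurrences_cvg (fun n m => m%:R / s n)).
have s0 : \forall n \near \oo, 0 < s n by move/cvgryPgt : soo; apply.
have m0 : mean n / s n / s n @[n --> \oo] --> 0.
  by rewrite -(mulr0 c); apply: cvgM => //; exact/(gtr0_cvgV0 s0).
(* Half of the distance from [x] to [c] absorbs the gap between [mean n / s n] and [c]; the other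
   half is the deviation given to Chebyshev. *)
pose d := `|x - c| / 2.
have d0 : 0 < d by rewrite divr_gt0// normr_gt0 subr_eq0.
apply/subr_cvg0; apply: norm_cvg0.
apply: (@squeeze_cvgr _ _ _ _ (fun=> 0)
  (fun n => mean n / s n / s n * (d ^- 2))); last 2 first.
- exact: cvg_cst.
- by rewrite -(mul0r (d ^- 2)); apply: cvgMl.
have near_mean : \forall n \near \oo, `|c - mean n / s n| < d.
  by move/cvgrPdist_lt : mc; apply.
near=> n; rewrite normr_ge0 /=.
have sn : 0 < s n by near: n.
have mn : `|c - mean n / s n| < d by near: n.
have -> : mean n / s n / s n * d ^- 2 = mean n / (d * s n) ^+ 2.
  by field; rewrite !gt_eqF.
apply: le_trans (mallows_count_chebyshev q1 n (k_ n).-1 (mulr_gt0 d0 sn)).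
pose N (t : 'S_n) : R := (count_below (k_ n).-1 t)%:R.
(* If [x] separates [N t / s n] from [c], the count is far from its mean. *)
have bad (t : 'S_n) : (N t / s n <= x) != (c <= x) ->
    d * s n <= `|N t - mean n|.
  move=> cx; rewrite -(@ler_pM2r _ (s n)^-1) ?invr_gt0// mulfK ?gt_eqF//.
  rewrite -[in leRHS](gtr0_norm (_ : 0 < (s n)^-1)) ?invr_gt0// -normrM mulrBl.
  move: cx mn; rewrite /d.
  case: (leP c x) => cx; rewrite ?eqb_id ?eqbF_neg ?negbK -?ltNge => Nx.
    rewrite (@ger0_norm _ (x - c)) ?subr_ge0// ltr_norml ler_normr.
    move=> /andP[? ?].
    apply/orP; left; lra.
  rewrite (@ltr0_norm _ (x - c)) ?subr_lt0// ltr_norml ler_normr => /andP[? ?].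
  apply/orP; right; lra.
have w0 t : 0 <= w t by exact: mallows_weight_ge0.
have [cx|xc'] := leP c x.
  rewrite -[true%:R](sum_mallows_weight q n).
  rewrite [X in _ - X](bigID (fun t => N t / s n <= x)) /=.
  rewrite opprD addrA subrr sub0r normrN ger0_norm; last first.
    by apply: sumr_ge0 => t _; exact: w0.
  rewrite big_mkcond [leRHS]big_mkcond /=; apply: ler_sum => t _.
  case: ifPn => [tx|_]; last by case: ifP => // _; exact: w0.
  by rewrite bad// cx (negbTE tx).
rewrite subr0 ger0_norm; last by apply: sumr_ge0 => t _; exact: w0.
rewrite big_mkcond [leRHS]big_mkcond /=; apply: ler_sum => t _.
case: ifPn => [tx|_]; last by case: ifP => // _; exact: w0.
by rewrite bad// -/(N t) tx leNgt xc'.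
Unshelve. all: by end_near. Qed.

End convergence.

(** * Distribution functions of the Dirac and Poisson limits *)

Section limit_laws.
Context {R : realType}.

Lemma dirac_itvNyc (c r : R) :
  (dirac c : probability R R) `]-oo, r]%classic = (c <= r)%R%:R%:E.
Proof.
rewrite /= diracE; suff -> : (c \in `]-oo, r]%classic) = (c <= r) by [].
by apply/idP/idP; rewrite inE /= in_itv.
Qed.

(** At [c] the distribution function has value 1 but left limit 0. *)
Lemma dirac_continuity_point (c x : R) :
  {for x, continuous
    (fun r : R => (dirac c : probability R R) `]-oo, r]%classic)} ->
  x != c.
Proof.
move=> cont; apply/eqP => xc; subst x.
have l1 : (c <= r)%R%:R%:E @[r --> c^'-] --> (1 : R)%:E.
  apply: cvg_at_left_filter; move: cont; rewrite /prop_for /continuous_at.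
  rewrite dirac_itvNyc lexx; apply: cvg_trans; apply: near_eq_cvg.
  by apply: nearW => r; rewrite dirac_itvNyc.
have l0 : (c <= r)%R%:R%:E @[r --> c^'-] --> (0 : R)%:E.
  apply: cvg_near_cst; near=> r.
  have rc : r < c by near: r; exact: nbhs_left_lt.
  by rewrite leNgt rc.
suff: (1 : R)%:E = 0%:E by move=> [/eqP]; rewrite oner_eq0.
exact: (cvg_unique (@ereal_hausdorff R) l1 l0).
Unshelve. all: by end_near. Qed.

Lemma poisson_real_lt0 (l x : R) : 0 < l -> x < 0 ->
  poisson_real l `]-oo, x]%classic = 0%E.
Proof.
move=> l0 x0; rewrite /poisson_real /distribution /pushforward /=.
rewrite /poisson_prob l0 (_ : _ @^-1` _ = set0) ?esum_set0//.
apply/seteqP; split => // m /=; rewrite in_itv /= /natr_fun => mx.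
by have := lt_le_trans x0 (ler0n R m); rewrite ltNge mx.
Qed.

Lemma poisson_real_ge0 (l x : R) : 0 < l -> 0 <= x ->
  poisson_real l `]-oo, x]%classic =
  (\sum_(m < (Num.truncn x).+1) l ^+ m / m`!%:R * expR (- l))%:E.
Proof.
move=> l0 x0; rewrite /poisson_real /distribution /pushforward /=.
rewrite /poisson_prob l0 (_ : _ @^-1` _ = `I_(Num.truncn x).+1); last first.
  apply/seteqP; split => m /=; rewrite in_itv /= /natr_fun ltnS;
    by rewrite truncn_ge_nat.
rewrite esum_fset//; last by move=> m _; rewrite lee_fin poisson_pmf_ge0.
rewrite -fsbig_ord sumEFin; congr (_%:E).
by apply: eq_bigr => m _; rewrite /poisson_pmf l0.
Qed.

Lemma mallows_count_cdf (q : {posnum R}) n a (x : R) : q%:num < 1 -> 0 <= x ->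
  \sum_(s : 'S_n | (count_below a s)%:R <= x)
    q%:num ^+ inversions s / mallows_norm n q =
  \sum_(m < (Num.truncn x).+1) (bernoulli_pgf (code_prob q%:num a) n)`_m.
Proof.
move=> q1 x0; rewrite big_mkcond /=.
under [RHS]eq_bigr do rewrite -mallows_count_pmf// big_mkcond.
rewrite exchange_big /=; apply: eq_bigr => s _.
rewrite -big_mkcond /=; under [RHS]eq_bigl do rewrite eq_sym.
by rewrite (@big_ord1_eq _ _ _ (fun=> _)) ltnS truncn_ge_nat.
Qed.

End limit_laws.

(** * The four regimes *)

Theorem theorem7 (R : realType) (q : {posnum R}) (q1 : q%:num < 1)
    (k_ : nat -> nat) (hk : forall n, (0 < n)%N -> (1 <= k_ n <= n)%N) :
  [/\ forall k, (1 <= k)%N ->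
        cvg_in_distribution
          (fun n => PF_RV q (fun p : PF n => (occurrences k p)%:R / n%:R))
          (dirac ((1 - q%:num) * q%:num ^+ (k - 1))),
      n%:R * q%:num ^+ k_ n @[n --> \oo] --> +oo ->
        cvg_in_distribution
          (fun n => PF_RV q (fun p : PF n =>
             (occurrences (k_ n) p)%:R / (n%:R * q%:num ^+ k_ n)))
          (dirac ((1 - q%:num) / q%:num)),
      forall L : R, 0 < L -> n%:R * q%:num ^+ k_ n @[n --> \oo] --> L ->
        cvg_in_distribution
          (fun n => PF_RV q (fun p : PF n => (occurrences (k_ n) p)%:R))
          (poisson_real ((1 - q%:num) / q%:num * L))
    & n%:R * q%:num ^+ k_ n @[n --> \oo] --> 0 ->
        cvg_in_distribution
          (fun n => PF_RV q (fun p : PF n => (occurrences (k_ n) p)%:R))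
          (dirac (0 : R))].
Proof.
have q01 : 0 < q%:num < 1 by rewrite q1 andbT.
have n_gt0 : \forall n \near \oo, (0 < n)%N by exact: nbhs_infty_gt.
have k_gt0 : \forall n \near \oo, (0 < k_ n)%N.
  by apply: filterS n_gt0 => n /hk /andP[].
have nV0 : (n%:R : R)^-1 @[n --> \oo] --> 0.
  apply/gtr0_cvgV0; last exact: cvgr_idn.
  by apply: filterS n_gt0 => n; rewrite ltr0n.
(* The table value is [k - 1], which produces the factor [1 / q] in the limits. *)
have qk : \forall n \near \oo, q%:num ^+ (k_ n).-1 = q%:num ^+ k_ n / q%:num.
  by apply: filterS k_gt0 => n kn; rewrite -[in RHS](prednK kn) exprSr mulfK.
split=> [k k0 x /dirac_continuity_point xc|t_oo x /dirac_continuity_point xc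
        |L L0 tL x _|t0 x _]; rewrite ?dirac_itvNyc.
- apply: (@occurrences_concentration _ _ q1 (fun=> k) _ (fun n => n%:R)).
  + exact: nearW.
  + exact: xc.
  + exact: cvgr_idn.
  rewrite subn1; apply: (@sum_code_prob_cvg _ _ (fun=> k.-1)) => //.
  + by apply: filterS n_gt0 => n; rewrite ltr0n.
  + apply: cvg_near_cst; apply: filterS n_gt0 => n n0.
    by rewrite mulrAC divff ?mul1r// pnatr_eq0 -lt0n.
  + by rewrite -(mulr0 (k.-1%:R * q%:num ^+ k.-1)); apply: cvgMr.
  + by rewrite -(mulr0 (q%:num ^+ k.-1)); apply: cvgMr.
- have s0 : \forall n \near \oo, 0 < n%:R * q%:num ^+ k_ n :> R.
    by apply: filterS n_gt0 => n n0; rewrite mulr_gt0 ?ltr0n ?exprn_gt0.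
  have sV0 : (n%:R * q%:num ^+ k_ n)^-1 @[n --> \oo] --> (0 : R).
    exact/(gtr0_cvgV0 s0).
  apply: occurrences_concentration => //.
  apply: (@sum_code_prob_cvg _ _ (fun n => (k_ n).-1)) => //.
  + apply: cvg_near_cst; near=> n.
    have n0 : (0 < n)%N by near: n.
    have -> : q%:num ^+ (k_ n).-1 = q%:num ^+ k_ n / q%:num by near: n.
    by field; rewrite !gt_eqF ?exprn_gt0 ?ltr0n.
  (* By [mul_expr_le] the numerator is bounded, while the scale diverges. *)
  + apply: (@squeeze_cvgr _ _ _ _ (fun=> 0)
      (fun n => (1 - q%:num)^-1 * (n%:R * q%:num ^+ k_ n)^-1)).
    * apply: filterS s0 => n sn; rewrite divr_ge0 ?(ltW sn)// ?mulr_ge0//=.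
      by rewrite ler_wpM2r ?mul_expr_le// invr_ge0 ltW.
    * exact: cvg_cst.
    * by rewrite -(mulr0 (1 - q%:num)^-1); apply: cvgMr.
  + apply: (@squeeze_cvgr _ _ _ _ (fun=> 0)
      (fun n => (n%:R * q%:num ^+ k_ n)^-1)) => //.
      apply: filterS s0 => n sn; rewrite divr_ge0 ?(ltW sn)//=.
      by rewrite ler_piMl ?invr_ge0 ?(ltW sn)// exprn_ile1// ltW.
    exact: cvg_cst.
- have qa0 : q%:num ^+ (k_ n).-1 @[n --> \oo] --> (0 : R).
    apply: cvg_trans (_ : (fun n => n%:R * q%:num ^+ k_ n / n%:R / q%:num) @ \oo
      --> (0 : R)); last first.
      by rewrite -(mul0r q%:num^-1) -(mulr0 L); apply: cvgMl; exact: cvgM.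
    apply: near_eq_cvg; near=> n.
    have n0 : (0 < n)%N by near: n.
    have -> : q%:num ^+ (k_ n).-1 = q%:num ^+ k_ n / q%:num by near: n.
    by rewrite [n%:R * _]mulrC mulfK// pnatr_eq0 -lt0n.
  have aqa0 : (k_ n).-1%:R * q%:num ^+ (k_ n).-1 @[n --> \oo] --> (0 : R).
    (* With [r] the square root of [q], [a * q ^+ a] is the bounded [a * r ^+ a] times the vanishing
       [r ^+ a]. *)
    pose r := Num.sqrt q%:num.
    have r0 : 0 < r by rewrite sqrtr_gt0.
    have r1 : r < 1 by rewrite -sqrtr1 ltr_sqrt.
    have rE m : Num.sqrt (q%:num ^+ m) = r ^+ m.
      rewrite -{1}[q%:num]sqr_sqrtr// exprAC sqrtr_sqr.
      by rewrite ger0_norm ?exprn_ge0 ?ltW.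
    apply: (@squeeze_cvgr _ _ _ _ (fun=> 0)
      (fun n => (1 - r)^-1 * Num.sqrt (q%:num ^+ (k_ n).-1))).
    * apply: nearW => n; rewrite mulr_ge0//= rE -{1}[q%:num]sqr_sqrtr//.
      rewrite exprAC expr2 mulrA ler_wpM2r ?exprn_ge0 ?(ltW r0)//.
      by apply: mul_expr_le; rewrite r0.
    * exact: cvg_cst.
    * rewrite -(mulr0 (1 - r)^-1) -sqrtr0; apply: cvgMr.
      by apply: continuous_cvg => //; exact: sqrt_continuous.
  have mean_cvg : \sum_(j < n) code_prob q%:num (k_ n).-1 j @[n --> \oo] -->
      (1 - q%:num) / q%:num * L.
    rewrite -mulrA (_ : (fun n => _) =
      (fun n => (\sum_(j < n) code_prob q%:num (k_ n).-1 j) / 1)); last first.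
      by apply/funext => n; rewrite divr1.
    apply: (@sum_code_prob_cvg _ _ (fun n => (k_ n).-1) (fun=> 1)) => //.
    + exact: nearW.
    + rewrite [X in _ --> X]mulrC; apply: cvg_trans (cvgMl tL).
      apply: near_eq_cvg; apply: filterS qk => n ->.
      by rewrite divr1 mulrA.
    + by under eq_fun do rewrite divr1.
    + by under eq_fun do rewrite divr1.
  have l0 : 0 < (1 - q%:num) / q%:num * L by rewrite !mulr_gt0 ?subr_gt0.
  have [x0|x0] := ltP x 0.
    rewrite poisson_real_lt0//.
    apply: (@cdf_occurrences_cvg _ _ _ k_gt0 (fun _ m => m%:R) x 0).
    apply: cvg_near_cst; apply: nearW => n; rewrite big_pred0// => s.
    by rewrite leNgt (lt_le_trans x0).
  rewrite poisson_real_ge0//.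
  apply: (@cdf_occurrences_cvg _ _ _ k_gt0 (fun _ m => m%:R)).
  under eq_fun do rewrite mallows_count_cdf//.
  apply: cvg_big => [|m _]; first exact: add_continuous.
  apply: coef_bernoulli_pgf_cvg qa0 mean_cvg.
  + by move=> n j; apply: code_prob_itv01.
  + by move=> n j; have /andP[] := code_prob_itv (k_ n).-1 j q01.
- apply: (@cdf_occurrences_cvg _ _ _ k_gt0 (fun _ m => m%:R)).
  have [x0|x0] := leP 0 x; last first.
    apply: cvg_near_cst; apply: nearW => n; rewrite big_pred0// => s.
    by rewrite leNgt (lt_le_trans x0).
  (* For [x >= 0] the distribution function is at least the probability of a zero count, hence at
     least 1 minus the mean, and each of the [n] parameters is at most [q ^+ (k_ n).-1]. *)
  apply: (@squeeze_cvgr _ _ _ _ (fun n => 1 - n%:R * q%:num ^+ k_ n / q%:num)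
    (fun=> 1)); last 2 first.
  + rewrite -[in X in _ --> X](subr0 1) -(mul0r q%:num^-1).
    by apply: cvgB; [exact: cvg_cst | exact: cvgMl].
  + exact: cvg_cst.
  apply: filterS qk => n qkn; apply/andP; split.
    apply: (@le_trans _ _ (bernoulli_pgf (code_prob q%:num (k_ n).-1) n)`_0).
      apply: le_trans (coef0_bernoulli_pgf_ge _ _).
        rewrite lerD2l lerN2 -mulrA -qkn.
        apply: (@le_trans _ _ (\sum_(j < n) q%:num ^+ (k_ n).-1)).
          apply: ler_sum => j _.
          by have /andP[] := code_prob_itv (k_ n).-1 j q01.
        by rewrite sumr_const card_ord mulr_natl.
      by move=> j; apply: code_prob_itv01.
    rewrite -mallows_count_pmf// big_mkcond [leRHS]big_mkcond /=.
    apply: ler_sum => s _; case: eqP => [->|_]; first by rewrite x0.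
    by case: ifP => // _; exact: mallows_weight_ge0.
  rewrite -(sum_mallows_weight q n) [leLHS]big_mkcond /=.
  apply: ler_sum => s _; case: ifP => // _; exact: mallows_weight_ge0.
Unshelve. all: by end_near. Qed.
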